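(* Let $TM=D\oplus D^{\bot}$ with $\dim D=n\geq 2$, and let $M$ be a Riemannian manifold of constant sectional curvature $c$ endowed with the semi-symmetric metric connection $\widetilde{\nabla}$. Then for every unit vector field $X\in\Gamma(D)$, $$\widetilde{\mathrm{Ric}}^D(X)\leq (n-1)c-\lambda+(2-n)\alpha(X,X)+\frac{n^2}{4}\|\widetilde{H}\|^2+\frac{\|\widetilde{B}^X\|^2}{2}+A^D(X).$$
   Context: $(M,g)$ is a smooth Riemannian manifold with Levi-Civita connection $\nabla$. $D\subseteq TM$ is a smooth subbundle (distribution) of constant rank $n$ that is non integrable, i.e. there are $X,Y\in\Gamma(D)$ with $[X,Y]\notin\Gamma(D)$. $D^\bot$ is its orthogonal complement, $\pi^D:TM\to D$ and $\pi^{D^\bot}:TM\to D^\bot$ are the orthogonal projections, $[X,Y]^D=\pi^D[X,Y]$, $[X,Y]^{D^\bot}=\pi^{D^\bot}[X,Y]$. For $X,Y\in\Gamma(D)$, $B(X,Y)=\pi^{D^\bot}(\nabla_XY)$. $U$ is a vector field on $M$, $\omega(V)=g(U,V)$. The semi-symmetric metric connection on $M$ is $\widetilde\nabla_XY=\nabla_XY+\omega(Y)X-g(X,Y)U$. For $X,Y\in\Gamma(D)$ put $\widetilde\nabla^D_XY=\pi^D(\widetilde\nabla_XY)$, $\widetilde B(X,Y)=\pi^{D^\bot}(\widetilde\nabla_XY)$, and $$\widetilde R^D(X,Y)Z=\widetilde\nabla^D_X\widetilde\nabla^D_YZ-\widetilde\nabla^D_Y\widetilde\nabla^D_XZ-\widetilde\nabla^D_{[X,Y]^D}Z-\pi^D[[X,Y]^{D^\bot},Z],$$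 with $\widetilde R^D(X,Y,Z,W)=g(\widetilde R^D(X,Y)Z,W)$. Given a unit $X\in\Gamma(D)$, let $\{E_1,\dots,E_n\}$ be a local orthonormal frame of $D$ with $E_1=X$. Define $\widetilde{\mathrm{Ric}}^D(X)=\sum_{j=2}^n\widetilde R^D(X,E_j,E_j,X)$; $A^D(X)=\sum_{j=2}^n g(B(E_j,X),[E_j,X])$; $\|\widetilde B^X\|^2=\sum_{j=2}^n[g(\widetilde B(X,E_j),\widetilde B(X,E_j))+g(\widetilde B(E_j,X),\widetilde B(E_j,X))]$; $\widetilde H=\frac1n\sum_{i=1}^n\widetilde B(E_i,E_i)$; $\alpha(X,Y)=(\nabla_X\omega)(Y)-\omega(X)\omega(Y)+\frac12 g(X,Y)\omega(U)$; $\lambda=\sum_{j=1}^n\alpha(E_j,E_j)$. *)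

(* Defs.v *)
From HB Require Import structures.
From mathcomp Require Import all_boot all_order all_algebra.
From mathcomp Require Import all_classical all_reals all_analysis.
Set Implicit Arguments.
Unset Strict Implicit.
Unset Printing Implicit Defensive.
Import Order.TTheory GRing.Theory Num.Theory.
Import numFieldNormedType.Exports.
Local Open Scope classical_set_scope.
Local Open Scope ring_scope.

(* Meant for an open A: all iterated partial derivatives up to order k exist
   on A and are continuous there. *)
Fixpoint Ck (R : realType) (m k : nat) (A : set 'rV[R]_m)
    (f : 'rV[R]_m -> R) : Prop :=
  {in A, continuous f} /\
  if k is k'.+1 then
    forall i : 'I_m,
      {in A, forall x, derivable f x (delta_mx 0 i)} /\
      Ck k' A (fun x => 'D_(delta_mx 0 i) f x)
  else True.

Definition Cinf (R : realType) (m : nat) (A : set 'rV[R]_m)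
    (f : 'rV[R]_m -> R) : Prop :=
  forall k, Ck k A f.

(* [chart_map] and [chart_inv] are total functions; they are meaningful on
   [chart_dom] and on its image only. *)
Record chart (R : realType) (m : nat) (M : topologicalType) := Chart {
  chart_dom : set M ;
  chart_map : M -> 'rV[R]_m ;
  chart_inv : 'rV[R]_m -> M ;
  chart_dom_open : open chart_dom ;
  chart_image_open : open (chart_map @` chart_dom) ;
  chart_mapK : forall p, chart_dom p -> chart_inv (chart_map p) = p ;
  chart_map_continuous : {in chart_dom, continuous chart_map} ;
  chart_inv_continuous :
    {in chart_map @` chart_dom, continuous chart_inv} }.

Record smooth_manifold (R : realType) (m : nat) := SmoothManifold {
  manifold_carrier :> topologicalType ;
  manifold_hausdorff : hausdorff_space manifold_carrier ;
  manifold_second_countable : @second_countable manifold_carrier ;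
  atlas : set (chart R m manifold_carrier) ;
  atlas_cover :
    forall p : manifold_carrier, exists2 c, atlas c & chart_dom c p ;
  atlas_compatible : forall c1 c2, atlas c1 -> atlas c2 ->
    forall i : 'I_m,
      Cinf (chart_map c1 @` (chart_dom c1 `&` chart_dom c2))
           (fun x => chart_map c2 (chart_inv c1 x) 0 i) }.

Section SmoothFunctions.
Context {R : realType} {m : nat} {M : smooth_manifold R m}.

(* Meant for an open O. *)
Definition smooth_on (O : set M) (f : M -> R) : Prop :=
  forall c, atlas c ->
    Cinf (chart_map c @` (O `&` chart_dom c)) (f \o chart_inv c).

Definition smooth_at (p : M) (f : M -> R) : Prop :=
  exists2 O, open_nbhs p O & smooth_on O f.

End SmoothFunctions.

(* The tangent space at p consists of the derivations of the algebra of germs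
   at p of smooth functions.  Such a derivation is represented by a functional
   on all functions M -> R that depends only on the germ at p.  The value 0 on
   functions that are not smooth near p makes the representation unique. *)
Notation tvec M R := ((manifold_carrier M -> R) -> R).

(* A (possibly only locally meaningful) field of tangent vectors; addition and
   scaling are the pointwise ones of function spaces. *)
Notation tfield M R := (manifold_carrier M -> tvec M R).

Section Fields.
Context {R : realType} {m : nat} {M : smooth_manifold R m}.

Definition tangent (p : M) : set (tvec M R) :=
  [set v | [/\ forall a f h, smooth_at p f -> smooth_at p h ->
                 v (fun q => a * f q + h q) = a * v f + v h,
               forall f h, smooth_at p f -> smooth_at p h ->
                 v (fun q => f q * h q) = f p * v h + h p * v f,
               forall f h, (\forall q \near p, f q = h q) -> v f = v h
             & forall f, ~ smooth_at p f -> v f = 0]].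

(* X is a smooth vector field on the open set O (no constraint outside O). *)
Definition vector_field (O : set M) (X : tfield M R) : Prop :=
  (forall p, O p -> tangent p (X p)) /\
  (forall (O' : set M) f, open O' -> O' `<=` O -> smooth_on O' f ->
     smooth_on O' (fun p => X p f)).

Definition lie_bracket (X Y : tfield M R) : tfield M R := fun p f =>
  if `[< smooth_at p f >] then X p (fun q => Y q f) - Y p (fun q => X q f)
  else 0.

(* The values on vectors that are not tangent at p are irrelevant. *)
Record riemannian_metric := RiemannianMetric {
  metric_fun :> forall p : M, tvec M R -> tvec M R -> R ;
  metric_linear : forall p a u v w, tangent p u -> tangent p v ->
    tangent p w ->
    metric_fun p (a *: u + v) w = a * metric_fun p u w + metric_fun p v w ;
  metric_sym : forall p u v, tangent p u -> tangent p v ->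
    metric_fun p u v = metric_fun p v u ;
  metric_pos : forall p v, tangent p v -> v != 0 -> 0 < metric_fun p v v ;
  metric_smooth : forall (O : set M) X Y, open O ->
    vector_field O X -> vector_field O Y ->
    smooth_on O (fun p => metric_fun p (X p) (Y p)) }.

(* The conditions are imposed over every open set, so that [nabla] is an
   affine connection acting on local vector fields as well as global ones. *)
Definition affine_connection (nabla : tfield M R -> tfield M R -> tfield M R)
    : Prop :=
  forall O : set M, open O ->
  [/\ forall X Y, vector_field O X -> vector_field O Y ->
        vector_field O (nabla X Y),
      forall f X X' Y, smooth_on O f -> vector_field O X ->
        vector_field O X' -> vector_field O Y -> forall p, O p ->
        nabla (fun q => f q *: X q + X' q) Y p
          = f p *: nabla X Y p + nabla X' Y p
    & forall f X Y Y', smooth_on O f -> vector_field O X ->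
        vector_field O Y -> vector_field O Y' -> forall p, O p ->
        nabla X (fun q => f q *: Y q + Y' q) p
          = X p f *: Y p + f p *: nabla X Y p + nabla X Y' p].

Definition levi_civita (g : riemannian_metric)
    (nabla : tfield M R -> tfield M R -> tfield M R) : Prop :=
  [/\ affine_connection nabla,
      forall (O : set M) X Y, open O -> vector_field O X ->
        vector_field O Y -> forall p, O p ->
        nabla X Y p - nabla Y X p = lie_bracket X Y p
    & forall (O : set M) X Y Z, open O -> vector_field O X ->
        vector_field O Y -> vector_field O Z -> forall p, O p ->
        X p (fun q => g q (Y q) (Z q))
          = g p (nabla X Y p) (Z p) + g p (Y p) (nabla X Z p)].

Definition curvature (nabla : tfield M R -> tfield M R -> tfield M R)
    (X Y Z : tfield M R) : tfield M R :=
  nabla X (nabla Y Z) - nabla Y (nabla X Z) - nabla (lie_bracket X Y) Z.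

Definition lin_indep (k : nat) (v : 'I_k -> tvec M R) : Prop :=
  forall a : 'I_k -> R, \sum_(i < k) a i *: v i = 0 -> forall i, a i = 0.

Definition sectional_curvature (g : riemannian_metric)
    (nabla : tfield M R -> tfield M R -> tfield M R)
    (X Y : tfield M R) (p : M) : R :=
  g p (curvature nabla X Y Y p) (X p) /
  (g p (X p) (X p) * g p (Y p) (Y p) - g p (X p) (Y p) ^+ 2).

(* Tangent planes at p are given by local vector fields X, Y around p. *)
Definition constant_sectional_curvature (g : riemannian_metric)
    (nabla : tfield M R -> tfield M R -> tfield M R) (c : R) : Prop :=
  forall (O : set M) X Y p, open O -> vector_field O X ->
    vector_field O Y -> O p ->
    lin_indep (fun i : 'I_2 => if i == ord0 then X p else Y p) ->
    sectional_curvature g nabla X Y p = c.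

Definition local_frame (n : nat) (D : M -> set (tvec M R)) (O : set M)
    (E : 'I_n -> tfield M R) : Prop :=
  (forall i, vector_field O (E i)) /\
  (forall p, O p ->
     lin_indep (fun i => E i p) /\
     D p = [set v | exists a : 'I_n -> R, v = \sum_(i < n) a i *: E i p]).

Definition smooth_distribution (n : nat) (D : M -> set (tvec M R)) : Prop :=
  forall p, exists O (E : 'I_n -> tfield M R),
    open_nbhs p O /\ local_frame D O E.

Definition section_of (D : M -> set (tvec M R)) (X : tfield M R) : Prop :=
  vector_field setT X /\ forall p, D p (X p).

Definition non_integrable (D : M -> set (tvec M R)) : Prop :=
  exists X Y, [/\ section_of D X, section_of D Y
                & ~ section_of D (lie_bracket X Y)].

End Fields.

Arguments riemannian_metric {R m} M.

Section Distribution.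
Context {R : realType} {m : nat} {M : smooth_manifold R m}.
Variables (g : riemannian_metric M).
Variables (nabla : tfield M R -> tfield M R -> tfield M R).
Variables (D : M -> set (tvec M R)) (U : tfield M R).
Implicit Types (X Y Z W V : tfield M R) (p : M).

Definition orthonormal_frame (n : nat) (O : set M) (E : 'I_n -> tfield M R)
    : Prop :=
  local_frame D O E /\
  forall p, O p -> forall i j, g p (E i p) (E j p) = (i == j)%:R.

Definition orth (F : M -> set (tvec M R)) (p : M) : set (tvec M R) :=
  [set v | tangent p v /\ forall w, F p w -> g p v w = 0].

(* Orthogonal projection onto F: at p, the w in F p with V p - w orthogonal
   to F p. *)
Definition orth_proj (F : M -> set (tvec M R)) (V : tfield M R) : tfield M R :=
  fun p => xget 0 [set w | F p w /\ forall u, F p u -> g p (V p - w) u = 0].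

Definition piD := orth_proj D.
Definition piDperp := orth_proj (orth D).

Definition omega V p : R := g p (U p) (V p).

Definition sff X Y : tfield M R := piDperp (nabla X Y).

Definition semisym X Y : tfield M R := fun p =>
  nabla X Y p + omega Y p *: X p - g p (X p) (Y p) *: U p.

Definition semisymD X Y : tfield M R := piD (semisym X Y).
Definition semisym_sff X Y : tfield M R := piDperp (semisym X Y).

Definition semisym_curvD X Y Z : tfield M R :=
  semisymD X (semisymD Y Z) - semisymD Y (semisymD X Z)
  - semisymD (piD (lie_bracket X Y)) Z
  - piD (lie_bracket (piDperp (lie_bracket X Y)) Z).

Definition semisym_curvD4 X Y Z W p : R :=
  g p (semisym_curvD X Y Z p) (W p).

Definition alpha X Y p : R :=
  (X p (omega Y) - omega (nabla X Y) p) - omega X p * omega Y p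
  + 2^-1 * g p (X p) (Y p) * omega U p.

(* In what follows E is an orthonormal frame of D whose first element, of
   index 0, is X. *)
Section Frame.
Variables (n : nat) (E : 'I_n -> tfield M R) (X : tfield M R) (p : M).

Definition semisym_ricD : R :=
  \sum_(j < n | (0 < j)%N) semisym_curvD4 X (E j) (E j) X p.

Definition AD : R :=
  \sum_(j < n | (0 < j)%N) g p (sff (E j) X p) (lie_bracket (E j) X p).

Definition semisym_sff_norm2 : R :=
  \sum_(j < n | (0 < j)%N)
    (g p (semisym_sff X (E j) p) (semisym_sff X (E j) p)
     + g p (semisym_sff (E j) X p) (semisym_sff (E j) X p)).

Definition semisym_mean_curv : tvec M R :=
  n%:R^-1 *: \sum_(i < n) semisym_sff (E i) (E i) p.

Definition lambda : R := \sum_(j < n) alpha (E j) (E j) p.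

End Frame.
End Distribution.

(* Main.v *)
Require Import Defs.
From HB Require Import structures.
From mathcomp Require Import all_boot all_order all_algebra.
From mathcomp Require Import all_classical all_reals all_analysis.
From mathcomp Require Import ring lra.
Import Order.TTheory GRing.Theory Num.Theory.
Import numFieldNormedType.Exports.
Local Open Scope classical_set_scope.
Local Open Scope ring_scope.

Set Implicit Arguments.
Unset Strict Implicit.
Unset Printing Implicit Defensive.

(** The difference between the curvature of the semi-symmetric metric connection
    and that of the Levi-Civita connection is algebraic in alpha
    ([metric_semisym_curv]), so on an orthonormal pair (X, Y) in a space of
    constant curvature c one has R~(X, Y, Y, X) = c - alpha(X, X) - alpha(Y, Y).
    Because the semi-symmetric connection is metric, projecting it to D produces
    a Gauss equation ([gauss_equation])
      R~D(X,Y,Z,W) = R~(X,Y,Z,W) + <B~(Y,Z), B~(X,W)> - <B~(X,Z), B~(Y,W)>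
                     - <[X,Y], B(Z,W)>,
    whose last term is what remains of the non-integrability of D.  Put
    Y = Z = E_j, W = X and sum over j > 0.  The brackets add up to A^D(X), and
    the curvature terms to (n - 1) c - lambda + (2 - n) alpha(X, X).  Write b
    for B~(X, X) and s for the sum over j > 0 of B~(E_j, E_j), so that
    s + b = n H~.
    The remaining terms are then bounded by
      <s, b> <= |s + b|^2 / 4   and   - <u, v> <= (|u|^2 + |v|^2) / 2,
    the latter with u = B~(X, E_j) and v = B~(E_j, X).

    All of this takes place on the open set O that carries the frame, where
    projections to D are smooth because they are finite sums over the frame.
    For this one needs that smooth functions on O form an algebra, that smooth
    vector fields on O form a module over it, and that a connection satisfying
    its axioms over every open set is a local operator ([eq_nabla]). *)

(** * Smooth functions on open sets *)

Section CkClosure.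
Context {R : realType} {m : nat}.
Implicit Types (A B : set 'rV[R]_m) (f h : 'rV[R]_m -> R).

Lemma Ck_le k A f : Ck k.+1 A f -> Ck k A f.
Proof.
elim: k f => [|k IH] f [cf df]; first by split.
by split=> // i; have [dfi Cfi] := df i; split=> //; exact: IH.
Qed.

Lemma Ck_subset k A B f : B `<=` A -> Ck k A f -> Ck k B f.
Proof.
move=> BA; elim: k f => [|k IH] f [cf df].
  by split=> // x /set_mem Bx; apply: cf; exact/mem_set/BA.
split=> [x /set_mem Bx|i]; first by apply: cf; exact/mem_set/BA.
have [dfi Cfi] := df i; split; last exact: IH.
by move=> x /set_mem Bx; apply: dfi; exact/mem_set/BA.
Qed.

(** Continuity, differentiability and partial derivatives at a point of an open
    set only see the germ of the function there. *)
Lemma eq_Ck k A f h : open A -> (forall x, A x -> f x = h x) ->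
  Ck k A f -> Ck k A h.
Proof.
move=> oA; elim: k f h => [|k IH] f h fh [cf df];
  have fhx x : A x -> \forall y \near x, f y = h y by move=> Ax;
    apply: filterS (open_nbhs_nbhs (conj oA Ax)) => y; exact: fh.
all: have ch : {in A, continuous h} by
  move=> x xA; rewrite /continuous_at -fh; [|exact: set_mem];
  apply: cvg_trans (cf x xA); apply: (near_eq_cvg (F := nbhs x));
  exact: fhx _ (set_mem xA).
  by split.
split=> // i; have [dfi Cfi] := df i; split.
  move=> x xA; exact: (near_eq_derivable (fhx _ (set_mem xA)) (dfi x xA)).
apply: IH Cfi => x Ax; apply: near_eq_derive; exact: fhx _ Ax.
Qed.

Lemma Ck_cst k A (a : R) : Ck k A (fun=> a).
Proof.
elim: k a => [|k IH] a.
  by split=> // x _; exact: cst_continuous.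
split=> [x _|i]; first exact: cst_continuous.
split=> [x _|]; first exact: derivable_cst.
have -> : (fun x : 'rV[R]_m => 'D_(delta_mx 0 i) (fun=> a) x) = (fun=> 0).
  by apply/funext => x; exact: derive_cst.
exact: IH.
Qed.

Lemma CkD k A f h : open A -> Ck k A f -> Ck k A h ->
  Ck k A (fun x => f x + h x).
Proof.
move=> oA; elim: k f h => [|k IH] f h [cf df] [ch dh].
  by split=> // x xA; exact: continuousD (cf x xA) (ch x xA).
split=> [x xA|i]; first exact: continuousD (cf x xA) (ch x xA).
have [dfi Cfi] := df i; have [dhi Chi] := dh i; split=> [x xA|].
  by apply: derivableD; [exact: dfi|exact: dhi].
apply: eq_Ck (IH _ _ Cfi Chi) => // x /mem_set xA.
by rewrite -deriveD; [|exact: dfi|exact: dhi].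
Qed.

(** The derivative of a product involves the factors themselves as well as their
    derivatives, hence the weakening of the hypotheses from k + 1 to k. *)
Lemma CkM k A f h : open A -> Ck k A f -> Ck k A h ->
  Ck k A (fun x => f x * h x).
Proof.
move=> oA; elim: k f h => [|k IH] f h Cf Ch.
  case: Cf Ch => [cf _] [ch _]; split=> // x xA.
  exact: continuousM (cf x xA) (ch x xA).
have [Cf' Ch'] := (Ck_le Cf, Ck_le Ch).
case: Cf Ch => [cf df] [ch dh].
split=> [x xA|i]; first exact: continuousM (cf x xA) (ch x xA).
have [dfi Cfi] := df i; have [dhi Chi] := dh i; split=> [x xA|].
  by apply: derivableM; [exact: dfi|exact: dhi].
apply: eq_Ck (CkD oA (IH _ _ Cf' Chi) (IH _ _ Ch' Cfi)) => // x /mem_set xA.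
by rewrite deriveM; [|exact: dfi|exact: dhi].
Qed.

End CkClosure.

Section SmoothClosure.
Context {R : realType} {m : nat} {M : smooth_manifold R m}.
Implicit Types (O : set M) (f h : M -> R) (p : M).

(** This is where continuity of the inverse chart is used: it makes smoothness
    on O a statement about open subsets of the model space. *)
Lemma open_chart_image (c : chart R m M) O :
  open O -> open (chart_map c @` (O `&` chart_dom c)).
Proof.
move=> oO; rewrite openE => x [q [Oq cq] <-].
have cx : (chart_map c @` chart_dom c) (chart_map c q) by exists q.
have ci := chart_inv_continuous (mem_set cx).
have Oi : nbhs (chart_inv c (chart_map c q)) O.
  by rewrite chart_mapK//; exact: open_nbhs_nbhs.
have := ci _ Oi; have := open_nbhs_nbhs (conj (@chart_image_open _ _ _ c) cx).
rewrite /interior; apply: filterS2 => y [q' cq' <-] /=.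
by rewrite /nbhs /= chart_mapK// => Oq'; exists q'.
Qed.

Lemma smooth_on_subset O O' f : O' `<=` O -> smooth_on O f -> smooth_on O' f.
Proof.
move=> OO' sf c ac k; apply: Ck_subset (sf c ac k).
by apply: image_subset => q [/OO'].
Qed.

Lemma eq_smooth_on O f h : open O -> (forall p, O p -> f p = h p) ->
  smooth_on O f -> smooth_on O h.
Proof.
move=> oO fh sf c ac k; apply: eq_Ck (sf c ac k); first exact: open_chart_image.
by move=> x [q [Oq cq] <-] /=; rewrite chart_mapK// fh.
Qed.

Lemma smooth_on_cst O (a : R) : smooth_on O (fun=> a).
Proof. by move=> c ac k; exact: Ck_cst. Qed.

Lemma smooth_onD O f h : open O -> smooth_on O f -> smooth_on O h ->
  smooth_on O (fun p => f p + h p).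
Proof.
move=> oO sf sh c ac k; apply: CkD; first exact: open_chart_image.
  exact: sf.
exact: sh.
Qed.

Lemma smooth_onM O f h : open O -> smooth_on O f -> smooth_on O h ->
  smooth_on O (fun p => f p * h p).
Proof.
move=> oO sf sh c ac k; apply: CkM; first exact: open_chart_image.
  exact: sf.
exact: sh.
Qed.

Lemma smooth_onN O f : open O -> smooth_on O f -> smooth_on O (fun p => - f p).
Proof.
move=> oO sf; have := smooth_onM oO (smooth_on_cst O (-1)) sf.
by apply: eq_smooth_on => // p _; rewrite mulN1r.
Qed.

Lemma smooth_on_at O f p : open O -> O p -> smooth_on O f -> smooth_at p f.
Proof. by move=> oO Op sf; exists O. Qed.

End SmoothClosure.

(** * Tangent spaces and the metric on them *)

Section TangentVectors.
Context {R : realType} {m : nat} {M : smooth_manifold R m}.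
Implicit Types (p : M) (u v w : tvec M R) (O : set M).

Lemma tangentZD p a u v : tangent p u -> tangent p v -> tangent p (a *: u + v).
Proof.
move=> [uZD uM un u0] [vZD vM vn v0].
have E k : (a *: u + v) k = a * u k + v k by [].
split=> [b f h sf sh|f h sf sh|f h fh|f nf]; rewrite !E.
- by rewrite uZD// vZD//; ring.
- by rewrite uM// vM//; ring.
- by rewrite (un _ _ fh) (vn _ _ fh).
- by rewrite u0// v0// mulr0 addr0.
Qed.

Lemma tangent0 p : tangent p (0 : tvec M R).
Proof.
have -> : (0 : tvec M R) = (fun=> 0) by [].
by split=> // *; rewrite !mulr0 addr0.
Qed.

Lemma tangentD p u v : tangent p u -> tangent p v -> tangent p (u + v).
Proof. by move=> tu tv; rewrite -[u]scale1r; exact: tangentZD. Qed.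

Lemma tangentZ p a u : tangent p u -> tangent p (a *: u).
Proof. by move=> tu; rewrite -[_ *: _]addr0; exact/tangentZD/tangent0. Qed.

Lemma tangentN p u : tangent p u -> tangent p (- u).
Proof. by rewrite -scaleN1r; exact: tangentZ. Qed.

Lemma tangentB p u v : tangent p u -> tangent p v -> tangent p (u - v).
Proof. by move=> tu tv; apply: tangentD => //; exact: tangentN. Qed.

Lemma tangent_sum p (I : Type) (r : seq I) (P : pred I) (F : I -> tvec M R) :
  (forall i, P i -> tangent p (F i)) -> tangent p (\sum_(i <- r | P i) F i).
Proof.
move=> tF; elim/big_ind : _ => //; [exact: tangent0|move=> *; exact: tangentD].
Qed.

Lemma tangent_cst0 p v : tangent p v -> v (fun=> 0) = 0.
Proof.
move=> [vZD _ _ _]; have s0 : smooth_at p (fun=> 0 : R).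
  by apply: (smooth_on_at openT) => //; exact: smooth_on_cst.
have := vZD 1 _ _ s0 s0.
have -> : (fun q : M => 1 * 0 + 0 : R) = (fun=> 0).
  by apply/funext => q; rewrite mulr0 addr0.
by rewrite mul1r; lra.
Qed.

(** The Leibniz rule gives v(1) = v(1 * 1) = 2 v(1). *)
Lemma tangent_cst1 p v : tangent p v -> v (fun=> 1) = 0.
Proof.
move=> [_ vM _ _]; have s1 : smooth_at p (fun=> 1 : R).
  by apply: (smooth_on_at openT) => //; exact: smooth_on_cst.
have := vM _ _ s1 s1.
have -> : (fun q : M => 1 * 1 : R) = (fun=> 1).
  by apply/funext => q; rewrite mulr1.
by rewrite !mul1r; lra.
Qed.

Lemma tangent_opp p v f : tangent p v -> smooth_at p f ->
  v (fun q => - f q) = - v f.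
Proof.
move=> tv sf; have s0 : smooth_at p (fun=> 0 : R).
  by apply: (smooth_on_at openT) => //; exact: smooth_on_cst.
have [vZD _ _ _] := tv; have := vZD (-1) _ _ sf s0.
have -> : (fun q => -1 * f q + 0) = (fun q => - f q).
  by apply/funext => q; rewrite addr0 mulN1r.
by rewrite (tangent_cst0 tv) addr0 mulN1r.
Qed.

Lemma tangent_eq_on p O v f h : open O -> O p -> tangent p v ->
  (forall q, O q -> f q = h q) -> v f = v h.
Proof.
move=> oO Op [_ _ vn _] fh; apply: vn.
by apply: filterS (open_nbhs_nbhs (conj oO Op)) => q; exact: fh.
Qed.

Variable g : riemannian_metric M.

Lemma metricZDl p a u v w : tangent p u -> tangent p v -> tangent p w ->
  g p (a *: u + v) w = a * g p u w + g p v w.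
Proof. exact: Defs.metric_linear. Qed.

Lemma metricC p u v : tangent p u -> tangent p v -> g p u v = g p v u.
Proof. exact: Defs.metric_sym. Qed.

Lemma metric0l p w : tangent p w -> g p 0 w = 0.
Proof.
move=> tw; have := metricZDl (-1) (tangent0 p) (tangent0 p) tw.
by rewrite scaler0 addr0 mulN1r addNr.
Qed.

Lemma metricDl p u v w : tangent p u -> tangent p v -> tangent p w ->
  g p (u + v) w = g p u w + g p v w.
Proof. by move=> tu tv tw; rewrite -[u]scale1r metricZDl// mul1r scale1r. Qed.

Lemma metricZl p a u w : tangent p u -> tangent p w ->
  g p (a *: u) w = a * g p u w.
Proof.
move=> tu tw; rewrite -[_ *: _]addr0 metricZDl ?metric0l ?addr0//.
exact: tangent0.
Qed.

Lemma metricNl p u w : tangent p u -> tangent p w -> g p (- u) w = - g p u w.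
Proof. by move=> tu tw; rewrite -scaleN1r metricZl// mulN1r. Qed.

Lemma metricBl p u v w : tangent p u -> tangent p v -> tangent p w ->
  g p (u - v) w = g p u w - g p v w.
Proof.
by move=> tu tv tw; rewrite metricDl ?metricNl//; exact: tangentN.
Qed.

Lemma metricBBl p u1 u2 u3 w :
  tangent p u1 -> tangent p u2 -> tangent p u3 -> tangent p w ->
  g p (u1 - u2 - u3) w = g p u1 w - g p u2 w - g p u3 w.
Proof. by move=> t1 t2 t3 tw; rewrite !metricBl//; exact: tangentB. Qed.

Lemma metric_suml p (I : Type) (r : seq I) (P : pred I) (F : I -> tvec M R) w :
  (forall i, tangent p (F i)) -> tangent p w ->
  g p (\sum_(i <- r | P i) F i) w = \sum_(i <- r | P i) g p (F i) w.
Proof.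
move=> tF tw; elim: r => [|i r IH]; first by rewrite !big_nil metric0l.
rewrite !big_cons; case: (P i) => //; rewrite metricDl ?IH//.
by apply: tangent_sum => j _.
Qed.

Lemma metricDr p w u v : tangent p w -> tangent p u -> tangent p v ->
  g p w (u + v) = g p w u + g p w v.
Proof.
move=> tw tu tv; rewrite metricC ?metricDl//; last exact: tangentD.
by congr (_ + _); exact: metricC.
Qed.

Lemma metricZr p w a u : tangent p w -> tangent p u ->
  g p w (a *: u) = a * g p w u.
Proof.
move=> tw tu; rewrite metricC ?metricZl//; last exact: tangentZ.
by congr (_ * _); exact: metricC.
Qed.

Lemma metricNr p w u : tangent p w -> tangent p u -> g p w (- u) = - g p w u.
Proof. by move=> tw tu; rewrite -scaleN1r metricZr// mulN1r. Qed.

Lemma metricBr p w u v : tangent p w -> tangent p u -> tangent p v ->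
  g p w (u - v) = g p w u - g p w v.
Proof.
by move=> tw tu tv; rewrite metricDr ?metricNr//; exact: tangentN.
Qed.

Lemma metric_ge0 p v : tangent p v -> 0 <= g p v v.
Proof.
move=> tv; have [->|v0] := eqVneq v 0; last exact/ltW/Defs.metric_pos.
by rewrite metric0l//; exact: tangent0.
Qed.

Lemma metric_eq0 p v : tangent p v -> g p v v = 0 -> v = 0.
Proof.
move=> tv gv; apply/eqP/negPn/negP => v0.
by have := Defs.metric_pos g tv v0; rewrite gv ltxx.
Qed.

(** Positivity of |u + v|^2. *)
Lemma metric_le_halves p u v : tangent p u -> tangent p v ->
  - g p u v <= (g p u u + g p v v) / 2.
Proof.
move=> tu tv; have := metric_ge0 (tangentD tu tv).
rewrite metricDl ?metricDr//; last exact: tangentD.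
by rewrite (metricC tv tu); lra.
Qed.

(** Positivity of |u - v|^2, since |u + v|^2 - |u - v|^2 = 4 <u, v>. *)
Lemma metric_le_quarter p u v : tangent p u -> tangent p v ->
  g p u v <= g p (u + v) (u + v) / 4.
Proof.
move=> tu tv; have := metric_ge0 (tangentB tu tv).
rewrite metricBl ?metricBr//; last exact: tangentB.
rewrite metricDl ?metricDr//; last exact: tangentD.
by rewrite (metricC tv tu); lra.
Qed.

End TangentVectors.

(** * Vector fields on an open set *)

Section VectorFields.
Context {R : realType} {m : nat} {M : smooth_manifold R m}.
Variable O : set M.
Implicit Types (X Y Z : tfield M R) (f : M -> R).
Local Notation VF := (vector_field O).

Lemma vf_tangent X p : VF X -> O p -> tangent p (X p).
Proof. by move=> [tX _]; exact: tX. Qed.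

Lemma vf_subset O' X : O' `<=` O -> VF X -> vector_field O' X.
Proof.
move=> O'O [tX sX]; split=> [p /O'O|A f oA AO']; first exact: tX.
by apply: sX => // q /AO' /O'O.
Qed.

Lemma eq_vf X Y : (forall p, O p -> X p = Y p) -> VF X -> VF Y.
Proof.
move=> XY [tX sX]; split=> [p Op|A f oA AO sf].
  by rewrite -XY//; exact: tX.
by apply: eq_smooth_on (sX _ _ oA AO sf) => // q /AO Oq; rewrite XY.
Qed.

Lemma vfZD f X Y : smooth_on O f -> VF X -> VF Y ->
  VF (fun p => f p *: X p + Y p).
Proof.
move=> sf [tX sX] [tY sY]; split=> [p Op|A h oA AO sh].
  by apply: tangentZD; [exact: tX|exact: tY].
have -> : (fun p => (f p *: X p + Y p) h) = (fun p => f p * X p h + Y p h) by [].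
apply: smooth_onD => //; last exact: sY.
by apply: smooth_onM => //; [exact: smooth_on_subset sf|exact: sX].
Qed.

Lemma vf0 : VF (0 : tfield M R).
Proof.
split=> [p _|A f oA AO sf]; first exact: tangent0.
exact: smooth_on_cst.
Qed.

Lemma vfD X Y : VF X -> VF Y -> VF (X + Y).
Proof.
move=> vX vY; apply: eq_vf (vfZD (smooth_on_cst O 1) vX vY) => p _.
by rewrite scale1r.
Qed.

Lemma vfZ f X : smooth_on O f -> VF X -> VF (fun p => f p *: X p).
Proof.
by move=> sf vX; apply: eq_vf (vfZD sf vX vf0) => p _; rewrite addr0.
Qed.

Lemma vfB X Y : VF X -> VF Y -> VF (X - Y).
Proof.
move=> vX vY; apply: eq_vf (vfZD (smooth_on_cst O (-1)) vY vX) => p _.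
by rewrite scaleN1r addrC.
Qed.

Lemma vf_sum (I : Type) (r : seq I) (F : I -> tfield M R) :
  (forall i, VF (F i)) -> VF (fun p => \sum_(i <- r) F i p).
Proof.
move=> vF; elim: r => [|i r IH].
  by apply: eq_vf vf0 => p _; rewrite big_nil.
by apply: eq_vf (vfD (vF i) IH) => p _; rewrite big_cons.
Qed.

End VectorFields.

(** * Orthogonal projections to D and to its complement *)

Section Projections.
Context {R : realType} {m n : nat} {M : smooth_manifold R m}.
Variables (g : riemannian_metric M) (D : M -> set (tvec M R)).
Variables (O : set M) (oO : open O) (E : 'I_n -> tfield M R).
Hypothesis hE : orthonormal_frame g D O E.
Implicit Types (V W X Y : tfield M R) (p : M) (u v w : tvec M R).
Local Notation VF := (vector_field O).

Lemma frame_vf i : VF (E i).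
Proof. by have [[vE _] _] := hE. Qed.

Lemma frame_distribution p i : O p -> D p (E i p).
Proof.
have [[_ lE] _] := hE => /lE[_ ->] /=; exists (fun j => (j == i)%:R).
rewrite (bigD1 i)//= eqxx scale1r big1 ?addr0// => j /negPf ->.
by rewrite scale0r.
Qed.

Lemma distribution_tangent p v : O p -> D p v -> tangent p v.
Proof.
move=> Op; have [[vE lE] _] := hE; have [_ ->] := lE p Op.
move=> [a ->]; apply: tangent_sum => i _; apply: tangentZ.
exact: vf_tangent (vE i) Op.
Qed.

Lemma distribution_sum p (a : 'I_n -> R) : O p -> D p (\sum_i a i *: E i p).
Proof. by have [[_ lE] _] := hE => /lE[_ ->] /=; exists a. Qed.

Lemma distributionB p u v : O p -> D p u -> D p v -> D p (u - v).
Proof.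
move=> Op; have [[vE lE] _] := hE; have [_ ->] := lE p Op.
move=> [a ->] [b ->]; exists (fun i => a i - b i).
by rewrite -sumrB; apply: eq_bigr => i _; rewrite scalerBl.
Qed.

(** Two candidates for the projection differ by a vector of F orthogonal to F,
    which vanishes because the metric is definite.  Hence the choice made in the
    definition of the projection is harmless, and exhibiting one candidate
    computes it. *)
Lemma orth_projE (F : M -> set (tvec M R)) V p w : O p ->
  tangent p (V p) -> F p `<=` tangent p ->
  (forall u v, F p u -> F p v -> F p (u - v)) ->
  F p w -> (forall u, F p u -> g p (V p - w) u = 0) ->
  orth_proj g F V p = w.
Proof.
move=> Op tV tF FB Fw ow; apply: xget_unique => // u [Fu ou].
apply/eqP; rewrite -subr_eq0; apply/eqP.
have Fd := FB _ _ Fu Fw; have td := tF _ Fd.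
apply: (metric_eq0 (g := g) td).
have -> : g p (u - w) (u - w) = g p (V p - w) (u - w) - g p (V p - u) (u - w).
  rewrite -metricBl//; last 2 first.
  - by apply: tangentB => //; exact: tF.
  - by apply: tangentB => //; exact: tF.
  by congr (g p _ _); rewrite opprB [RHS]addrC addrA subrK.
by rewrite ow// ou// subrr.
Qed.

Lemma frame_expansion_orth V p u : O p -> tangent p (V p) -> D p u ->
  g p (V p - \sum_i g p (V p) (E i p) *: E i p) u = 0.
Proof.
move=> Op tV; have tE i : tangent p (E i p) by exact: vf_tangent (frame_vf i) Op.
have [[vE lE] oE] := hE; have ts a : tangent p (\sum_i a i *: E i p).
  by apply: tangent_sum => i _; exact: tangentZ.
have tB := tangentB tV (ts (fun i => g p (V p) (E i p))).
have oEi j : g p (V p - \sum_i g p (V p) (E i p) *: E i p) (E j p) = 0.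
  rewrite metricBl// metric_suml//; last by move=> i; exact: tangentZ.
  rewrite (bigD1 j)//= metricZl// oE// eqxx mulr1 big1 ?addr0 ?subrr// => i ij.
  by rewrite metricZl// oE// (negPf ij) mulr0.
have [_ ->] := lE p Op => -[a ->].
rewrite metricC// metric_suml//; last by move=> i; exact: tangentZ.
by rewrite big1// => i _; rewrite metricZl// metricC// oEi mulr0.
Qed.

Lemma piDE V p : O p -> tangent p (V p) ->
  piD g D V p = \sum_i g p (V p) (E i p) *: E i p.
Proof.
move=> Op tV; apply: orth_projE => //.
- by move=> v; exact: distribution_tangent.
- by move=> u v; exact: distributionB.
- exact: distribution_sum.
by move=> u; exact: frame_expansion_orth.
Qed.

Lemma piD_in V p : O p -> tangent p (V p) -> D p (piD g D V p).
Proof. by move=> Op tV; rewrite piDE//; exact: distribution_sum. Qed.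

Lemma piD_tangent V p : O p -> tangent p (V p) -> tangent p (piD g D V p).
Proof. by move=> Op tV; apply: distribution_tangent => //; exact: piD_in. Qed.

Lemma metric_piD V p w : O p -> tangent p (V p) -> D p w ->
  g p (piD g D V p) w = g p (V p) w.
Proof.
move=> Op tV Dw; have tw := distribution_tangent Op Dw.
have := frame_expansion_orth Op tV Dw; rewrite -piDE// metricBl//.
  by move/eqP; rewrite subr_eq0 => /eqP.
exact: piD_tangent.
Qed.

Lemma orth_tangent p v : orth g D p v -> tangent p v.
Proof. by case. Qed.

Lemma piDperpE V p : O p -> tangent p (V p) ->
  piDperp g D V p = V p - piD g D V p.
Proof.
move=> Op tV; have tP := piD_tangent Op tV; have DP := piD_in Op tV.
apply: orth_projE => //.
- by move=> v; exact: orth_tangent.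
- move=> u v [tu ou] [tv ov]; split; first exact: tangentB.
  move=> w Dw; have tw := distribution_tangent Op Dw.
  by rewrite metricBl// ou// ov// subrr.
- split; first exact: tangentB.
  move=> w Dw; have tw := distribution_tangent Op Dw.
  by rewrite metricBl// metric_piD// subrr.
by move=> u [tu ou]; rewrite opprB addrC subrK metricC// ou.
Qed.

Lemma piDperp_orth V p : O p -> tangent p (V p) -> orth g D p (piDperp g D V p).
Proof.
move=> Op tV; have tP := piD_tangent Op tV.
rewrite piDperpE//; split; first exact: tangentB.
move=> w Dw; have tw := distribution_tangent Op Dw.
by rewrite metricBl// metric_piD// subrr.
Qed.

Lemma piDperp_tangent V p : O p -> tangent p (V p) ->
  tangent p (piDperp g D V p).
Proof. by move=> Op tV; exact: orth_tangent (piDperp_orth Op tV). Qed.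

Lemma metric_piDperp V p w : O p -> tangent p (V p) -> orth g D p w ->
  g p w (piDperp g D V p) = g p w (V p).
Proof.
move=> Op tV [tw ow]; have tP := piD_tangent Op tV.
by rewrite piDperpE// metricBr// (ow _ (piD_in Op tV)) subr0.
Qed.

(** The frame formula of [piDE] has smooth coefficients; this is how smoothness
    of the projected field is obtained from a pointwise definition. *)
Lemma vf_piD V : VF V -> VF (piD g D V).
Proof.
move=> vV; have vF : VF (fun p => \sum_i g p (V p) (E i p) *: E i p).
  apply: (@vf_sum _ _ _ O _ _ (fun i q => g q (V q) (E i q) *: E i q)) => i.
  apply: vfZ => //; last exact: frame_vf.
  by apply: Defs.metric_smooth => //; exact: frame_vf.
by apply: (eq_vf _ vF) => p Op; rewrite piDE//; exact: vf_tangent vV Op.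
Qed.

Lemma vf_piDperp V : VF V -> VF (piDperp g D V).
Proof.
move=> vV; apply: (eq_vf _ (vfB vV (vf_piD vV))) => p Op.
by rewrite piDperpE//; exact: vf_tangent vV Op.
Qed.

End Projections.

(** * The Levi-Civita and semi-symmetric connections *)

Section Connection.
Context {R : realType} {m : nat} {M : smooth_manifold R m}.
Variables (g : riemannian_metric M).
Variables (nabla : tfield M R -> tfield M R -> tfield M R).
Hypothesis LC : levi_civita g nabla.
Variables (O : set M) (oO : open O) (U : tfield M R).
Hypothesis vU : vector_field O U.
Implicit Types (V W X Y Z : tfield M R) (p : M) (u v w : tvec M R).
Local Notation VF := (vector_field O).
Local Notation omega := (omega g U).
Local Notation semisym := (semisym g nabla U).
Local Notation "<| X , Y |>_ p" := (g p (X p) (Y p)) (at level 0).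

Lemma nabla_vf X Y : VF X -> VF Y -> VF (nabla X Y).
Proof. by move=> *; have [ac _ _] := LC; have [+ _ _] := ac O oO; apply. Qed.

Lemma nablaZDl f X X' Y p : smooth_on O f -> VF X -> VF X' -> VF Y -> O p ->
  nabla (fun q => f q *: X q + X' q) Y p = f p *: nabla X Y p + nabla X' Y p.
Proof. by move=> *; have [ac _ _] := LC; have [_ + _] := ac O oO; apply. Qed.

Lemma nablaZDr f X Y Y' p : smooth_on O f -> VF X -> VF Y -> VF Y' -> O p ->
  nabla X (fun q => f q *: Y q + Y' q) p
  = X p f *: Y p + f p *: nabla X Y p + nabla X Y' p.
Proof. by move=> *; have [ac _ _] := LC; have [_ _ +] := ac O oO; apply. Qed.

Lemma torsion_free X Y p : VF X -> VF Y -> O p ->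
  nabla X Y p - nabla Y X p = lie_bracket X Y p.
Proof. by move=> *; have [_ + _] := LC; move=> /(_ O X Y oO); apply. Qed.

Lemma nabla_metric X Y Z p : VF X -> VF Y -> VF Z -> O p ->
  X p (fun q => <|Y, Z|>_q) = <|nabla X Y, Z|>_p + <|Y, nabla X Z|>_p.
Proof. by move=> *; have [_ _] := LC; move=> /(_ O X Y Z oO); apply. Qed.

(** The indicator of the complement of O need not be continuous on the
    boundary, but it is smooth on O, which is all that [eq_nabla] asks. *)
Lemma smooth_on_offind : smooth_on O (fun q => (q \notin O)%:R : R).
Proof.
apply: eq_smooth_on (smooth_on_cst O 0) => // q Oq.
by rewrite mem_set.
Qed.

(** Locality without bump functions.  If Z = Z' on O and h is the indicator of
    the complement of O, then Z = h (Z - Z') + Z' everywhere, and h is smooth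
    on O; the connection axioms over O then remove the first summand at p, as h
    and Z - Z' vanish there. *)
Lemma eq_nabla X X' Y Y' p : VF X -> VF X' -> VF Y -> VF Y' ->
  (forall q, O q -> X q = X' q) -> (forall q, O q -> Y q = Y' q) -> O p ->
  nabla X Y p = nabla X' Y' p.
Proof.
move=> vX vX' vY vY' XX' YY' Op.
have glue (Z Z' : tfield M R) : (forall q, O q -> Z q = Z' q) ->
    Z = (fun q => (q \notin O)%:R *: (Z - Z') q + Z' q).
  move=> ZZ'; apply/funext => q; case: (boolP (q \in O)) => [/set_mem Oq|_].
    by rewrite scale0r add0r ZZ'.
  by rewrite scale1r subrK.
rewrite (glue X X')// nablaZDl//; [|exact: smooth_on_offind|exact: vfB].
rewrite mem_set//= scale0r add0r (glue Y Y')// nablaZDr//.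
- have -> : (Y - Y') p = 0 by rewrite -[LHS]/(Y p - Y' p) YY'// subrr.
  by rewrite mem_set//= scale0r addr0 scaler0 add0r.
- exact: smooth_on_offind.
- exact: vfB.
Qed.

Lemma nablaDl X X' Y p : VF X -> VF X' -> VF Y -> O p ->
  nabla (X + X') Y p = nabla X Y p + nabla X' Y p.
Proof.
move=> vX vX' vY Op; have -> : X + X' = (fun q => 1 *: X q + X' q).
  by apply/funext => q; rewrite scale1r.
by rewrite (nablaZDl (f := fun=> 1))// ?scale1r//; exact: smooth_on_cst.
Qed.

Lemma nablaDr X Y Y' p : VF X -> VF Y -> VF Y' -> O p ->
  nabla X (Y + Y') p = nabla X Y p + nabla X Y' p.
Proof.
move=> vX vY vY' Op; have -> : Y + Y' = (fun q => 1 *: Y q + Y' q).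
  by apply/funext => q; rewrite scale1r.
rewrite (nablaZDr (f := fun=> 1))//; last exact: smooth_on_cst.
by rewrite (tangent_cst1 (vf_tangent vX Op)) scale0r add0r scale1r.
Qed.

(** Torsion-freeness expresses the bracket by covariant derivatives, so its
    smoothness needs no computation with second derivatives. *)
Lemma bracket_vf X Y : VF X -> VF Y -> VF (lie_bracket X Y).
Proof.
move=> vX vY; apply: eq_vf (vfB (nabla_vf vX vY) (nabla_vf vY vX)) => p Op.
exact: torsion_free.
Qed.

Lemma smooth_metric X Y : VF X -> VF Y -> smooth_on O (fun q => <|X, Y|>_q).
Proof. exact: Defs.metric_smooth. Qed.

Lemma semisym_vf X Y : VF X -> VF Y -> VF (semisym X Y).
Proof.
move=> vX vY; apply: (@vfB _ _ _ O (fun p => nabla X Y p + omega Y p *: X p)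
  (fun p => <|X, Y|>_p *: U p)).
  apply: vfD; first exact: nabla_vf.
  by apply: vfZ => //; exact: smooth_metric.
by apply: vfZ => //; exact: smooth_metric.
Qed.

Lemma metric_semisym X Y p w : VF X -> VF Y -> O p -> tangent p w ->
  g p (semisym X Y p) w
  = g p (nabla X Y p) w + omega Y p * g p (X p) w - <|X, Y|>_p * g p (U p) w.
Proof.
move=> vX vY Op tw; have tX := vf_tangent vX Op; have tU := vf_tangent vU Op.
have tN := vf_tangent (nabla_vf vX vY) Op.
rewrite /Defs.semisym metricBl ?metricDl ?metricZl//.
- exact: tangentZ.
- by apply: tangentD => //; exact: tangentZ.
- exact: tangentZ.
Qed.

(** The two correction terms of the connection contribute a skew-symmetric
    operator, so that metric compatibility of the Levi-Civita connection is
    preserved. *)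
Lemma semisym_metric X Y Z p : VF X -> VF Y -> VF Z -> O p ->
  X p (fun q => <|Y, Z|>_q) = <|semisym X Y, Z|>_p + <|Y, semisym X Z|>_p.
Proof.
move=> vX vY vZ Op; rewrite nabla_metric//.
have [tX tY tZ tU] := And4 (vf_tangent vX Op) (vf_tangent vY Op)
  (vf_tangent vZ Op) (vf_tangent vU Op).
rewrite (metricC g (u := Y p) (v := semisym X Z p))//; last first.
  exact: vf_tangent (semisym_vf vX vZ) Op.
rewrite !metric_semisym// (metricC g (u := Y p) (v := nabla X Z p))//.
  by rewrite /Defs.omega; ring.
exact: vf_tangent (nabla_vf vX vZ) Op.
Qed.

Lemma eq_semisym X X' Y Y' p : VF X -> VF X' -> VF Y -> VF Y' ->
  (forall q, O q -> X q = X' q) -> (forall q, O q -> Y q = Y' q) -> O p ->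
  semisym X Y p = semisym X' Y' p.
Proof.
move=> vX vX' vY vY' XX' YY' Op.
by rewrite /Defs.semisym /Defs.omega (eq_nabla vX vX' vY vY')// XX'// YY'.
Qed.

Lemma metric_semisymDl X X' Y p w : VF X -> VF X' -> VF Y -> O p ->
  tangent p w ->
  g p (semisym (X + X') Y p) w = g p (semisym X Y p) w + g p (semisym X' Y p) w.
Proof.
move=> vX vX' vY Op tw; rewrite !metric_semisym//; last exact: vfD.
have T V : VF V -> tangent p (V p) by move=> vV; exact: vf_tangent vV Op.
have [tX tX' tY] := And3 (T _ vX) (T _ vX') (T _ vY).
rewrite nablaDl// -[(X + X') p]/(X p + X' p) !metricDl//; try exact/T/nabla_vf.
by ring.
Qed.

Lemma metric_semisymDr X Y Y' p w : VF X -> VF Y -> VF Y' -> O p ->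
  tangent p w ->
  g p (semisym X (Y + Y') p) w = g p (semisym X Y p) w + g p (semisym X Y' p) w.
Proof.
move=> vX vY vY' Op tw; rewrite !metric_semisym//; last exact: vfD.
have T V : VF V -> tangent p (V p) by move=> vV; exact: vf_tangent vV Op.
have [tX tY tY' tU] := And4 (T _ vX) (T _ vY) (T _ vY') (T _ vU).
rewrite nablaDr// /Defs.omega -[(Y + Y') p]/(Y p + Y' p) !metricDr//.
rewrite metricDl//; try exact/T/nabla_vf.
by ring.
Qed.

(** Here the coefficients omega(Z) and g(Y, Z) are differentiated; the products
    with g(X, _) are left to [metric_semisym]. *)
Lemma metric_nabla_semisym X Y Z W p : VF X -> VF Y -> VF Z -> VF W -> O p ->
  <|nabla X (semisym Y Z), W|>_p
  = <|nabla X (nabla Y Z), W|>_p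
    + X p (omega Z) * <|Y, W|>_p + omega Z p * <|nabla X Y, W|>_p
    - X p (fun q => <|Y, Z|>_q) * omega W p - <|Y, Z|>_p * <|nabla X U, W|>_p.
Proof.
move=> vX vY vZ vW Op.
have sYZ := smooth_metric vY vZ; have sN := smooth_onN oO sYZ.
have -> : semisym Y Z = (fun q => omega Z q *: Y q
    + (- <|Y, Z|>_q *: U q + nabla Y Z q)).
  apply/funext => q; rewrite /Defs.semisym scaleNr.
  by rewrite [RHS]addrA [RHS]addrC addrA.
have vNYZ := nabla_vf vY vZ.
rewrite nablaZDr//; first last.
- exact: vfZD.
- exact: smooth_metric.
rewrite (nablaZDr (f := fun q => - <|Y, Z|>_q))//.
rewrite (tangent_opp (vf_tangent vX Op) (smooth_on_at oO Op sYZ)).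
have [tX tY tW tU] := And4 (vf_tangent vX Op) (vf_tangent vY Op)
  (vf_tangent vW Op) (vf_tangent vU Op).
have tXY := vf_tangent (nabla_vf vX vY) Op.
have tXU := vf_tangent (nabla_vf vX vU) Op.
have tXYZ := vf_tangent (nabla_vf vX vNYZ) Op.
rewrite !metricDl ?metricZl//; try (by do ![exact: tangentZ|apply: tangentD]).
by rewrite /Defs.omega; ring.
Qed.

(** R~ is the analogue of [curvature]: the bracket is not split along D. *)
Definition semisym_curv X Y Z : tfield M R :=
  semisym X (semisym Y Z) - semisym Y (semisym X Z)
  - semisym (lie_bracket X Y) Z.

(** Yano's formula.  After pairing with W everything is scalar: metric
    compatibility removes the derivatives of g(Y, Z), g(X, Z) and turns those of
    U into (nabla omega), torsion-freeness removes the bracket from the algebraic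
    terms, and what is left over is a polynomial identity. *)
Lemma metric_semisym_curv X Y Z W p :
  VF X -> VF Y -> VF Z -> VF W -> O p ->
  <|semisym_curv X Y Z, W|>_p
  = <|curvature nabla X Y Z, W|>_p
    + alpha g nabla U X Z p * <|Y, W|>_p - alpha g nabla U Y Z p * <|X, W|>_p
    + <|X, Z|>_p * alpha g nabla U Y W p - <|Y, Z|>_p * alpha g nabla U X W p.
Proof.
move=> vX vY vZ vW Op.
have vXY := nabla_vf vX vY; have vYX := nabla_vf vY vX.
have vXZ := nabla_vf vX vZ; have vYZ := nabla_vf vY vZ.
have vB := bracket_vf vX vY.
have T V : VF V -> tangent p (V p) by move=> vV; exact: vf_tangent vV Op.
have tW := T _ vW; have tU := T _ vU; have tX := T _ vX; have tY := T _ vY.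
have tZ := T _ vZ.
have nablaU V V' : VF V -> VF V' ->
    <|nabla V U, V'|>_p = V p (omega V') - omega (nabla V V') p.
  move=> vV vV'; have -> : V p (omega V') = V p (fun q => <|U, V'|>_q) by [].
  by rewrite nabla_metric// addrK.
have -> : semisym_curv X Y Z p = semisym X (semisym Y Z) p
  - semisym Y (semisym X Z) p - semisym (lie_bracket X Y) Z p by [].
have -> : curvature nabla X Y Z p = nabla X (nabla Y Z) p
  - nabla Y (nabla X Z) p - nabla (lie_bracket X Y) Z p by [].
have tS V V' : VF V -> VF V' -> tangent p (semisym V V' p).
  by move=> vV vV'; exact/T/semisym_vf.
have tN V V' : VF V -> VF V' -> tangent p (nabla V V' p).
  by move=> vV vV'; exact/T/nabla_vf.
have sXZ := semisym_vf vX vZ; have sYZ := semisym_vf vY vZ.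
rewrite (metricBBl g (tS _ _ vX sYZ) (tS _ _ vY sXZ) (tS _ _ vB vZ) tW).
rewrite (metricBBl g (tN _ _ vX vYZ) (tN _ _ vY vXZ) (tN _ _ vB vZ) tW).
rewrite !metric_semisym// !metric_nabla_semisym//.
(* Bring every occurrence of the semi-symmetric connection to the left slot of
   the metric, where [metric_semisym] expands it. *)
rewrite (metricC g tX (tS _ _ vY vZ)) (metricC g tY (tS _ _ vX vZ)).
rewrite -![omega (semisym _ _) p]/(g p (U p) _) !(metricC g tU (tS _ _ _ _))//.
rewrite !metric_semisym// !nabla_metric// !nablaU//.
rewrite -torsion_free// !metricBl//; try exact: tN.
rewrite /alpha /Defs.omega.
rewrite (metricC g tY tU) (metricC g tX tU) (metricC g tY tX).
rewrite (metricC g (tN _ _ vY vZ) tU) (metricC g (tN _ _ vY vZ) tX).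
rewrite (metricC g (tN _ _ vX vZ) tU) (metricC g (tN _ _ vX vZ) tY).
by field.
Qed.

End Connection.

(** * The Gauss equation of D *)

Section Gauss.
Context {R : realType} {m n : nat} {M : smooth_manifold R m}.
Variables (g : riemannian_metric M).
Variables (nabla : tfield M R -> tfield M R -> tfield M R).
Hypothesis LC : levi_civita g nabla.
Variables (D : M -> set (tvec M R)) (U : tfield M R).
Variables (O : set M) (oO : open O) (E : 'I_n -> tfield M R).
Hypotheses (hE : orthonormal_frame g D O E) (vU : vector_field O U).
Implicit Types (V W X Y Z : tfield M R) (p : M).
Local Notation VF := (vector_field O).
Local Notation semisym := (semisym g nabla U).
Local Notation semisymD := (semisymD g nabla D U).
Local Notation semisym_sff := (semisym_sff g nabla D U).
Local Notation sff := (sff g nabla D).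
Local Notation piD := (piD g D).
Local Notation piDperp := (piDperp g D).
Local Notation "<| X , Y |>_ p" := (g p (X p) (Y p)) (at level 0).

Let T V p : VF V -> O p -> tangent p (V p).
Proof. exact: vf_tangent. Qed.

Let semisym_vf := semisym_vf LC oO vU.
Let nabla_vf := nabla_vf LC oO.
Let vf_piD := vf_piD oO hE.
Let vf_piDperp := vf_piDperp oO hE.

Lemma piD_decomp V p : VF V -> O p -> V p = (piD V + piDperp V) p.
Proof.
move=> vV Op; rewrite -[RHS]/(piD V p + piDperp V p).
by rewrite (piDperpE hE Op (T vV Op)) addrC subrK.
Qed.

(** Differentiate <N, W> = 0 along X. *)
Lemma metric_nabla_orth X N W p : VF X -> VF N -> VF W ->
  (forall q, O q -> <|N, W|>_q = 0) -> O p ->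
  <|nabla X N, W|>_p = - <|N, nabla X W|>_p.
Proof.
move=> vX vN vW NW Op; apply/eqP; rewrite -addr_eq0; apply/eqP.
rewrite -(nabla_metric LC oO)// (tangent_eq_on oO Op (T vX Op) (h := fun=> 0))//.
exact: tangent_cst0 (T vX Op).
Qed.

(** Projecting the inner derivative discards the normal field B~(Y,Z).  As that
    field is orthogonal to W throughout O and the connection is metric, its
    derivative pairs with W to - <B~(Y,Z), B~(X,W)>. *)
Lemma gauss_semisymD2 X Y Z W p : VF X -> VF Y -> VF Z -> VF W ->
  (forall q, O q -> D q (W q)) -> O p ->
  <|semisymD X (semisymD Y Z), W|>_p
  = <|semisym X (semisym Y Z), W|>_p + <|semisym_sff Y Z, semisym_sff X W|>_p.
Proof.
move=> vX vY vZ vW DW Op.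
have vS := semisym_vf vY vZ; have vP := vf_piD vS; have vN := vf_piDperp vS.
have NW q : O q -> <|semisym_sff Y Z, W|>_q = 0.
  by move=> Oq; have [_ ->] := piDperp_orth hE Oq (T vS Oq); last exact: DW.
rewrite /Defs.semisymD (metric_piD hE)//; last 2 first.
- exact: T (semisym_vf _ _) _.
- exact: DW.
rewrite (metric_piDperp hE Op (T (semisym_vf vX vW) Op)); last first.
  exact: (piDperp_orth hE Op (T vS Op)).
rewrite (eq_semisym LC oO U vX vX vS (vfD vP vN))//;
  last by move=> q Oq; exact: piD_decomp.
rewrite (metric_semisymDr LC oO vU)//; last exact: T vW Op.
suff -> : <|semisym_sff Y Z, semisym X W|>_p
    = - <|semisym X (semisym_sff Y Z), W|>_p.
  by rewrite addrK.
apply/eqP; rewrite -addr_eq0 addrC -(semisym_metric LC oO vU)//.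
rewrite (tangent_eq_on oO Op (T vX Op) (h := fun=> 0))//.
by rewrite (tangent_cst0 (T vX Op)).
Qed.

(** The normal part N of [X, Y] acts on Z by the bracket [N, Z] instead of the
    connection.  Their difference is the derivative of N along Z, whose
    component in D is given by B; the two semi-symmetric correction terms drop
    out because N is orthogonal to Z and W. *)
Lemma gauss_bracket X Y Z W p : VF X -> VF Y -> VF Z -> VF W ->
  (forall q, O q -> D q (Z q)) -> (forall q, O q -> D q (W q)) -> O p ->
  <|semisymD (piD (lie_bracket X Y)) Z, W|>_p
  + <|piD (lie_bracket (piDperp (lie_bracket X Y)) Z), W|>_p
  = <|semisym (lie_bracket X Y) Z, W|>_p + <|lie_bracket X Y, sff Z W|>_p.
Proof.
move=> vX vY vZ vW DZ DW Op.
have vB := bracket_vf LC oO vX vY.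
have vP := vf_piD vB; have vN := vf_piDperp vB.
set N := piDperp (lie_bracket X Y) in vN *.
have tW := T vW Op; have tN := T vN Op; have tU := T vU Op.
have tZW := T (nabla_vf vZ vW) Op.
have oN q : O q -> orth g D q (N q).
  by move=> Oq; apply: (piDperp_orth hE Oq); exact: T vB Oq.
have NF V q : O q -> (forall q, O q -> D q (V q)) -> <|N, V|>_q = 0.
  by move=> Oq DV; have [_ ->] := oN q Oq; last exact: DV.
rewrite /Defs.semisymD.
rewrite (metric_piD hE)//; [|exact: T (semisym_vf vP vZ) Op|exact: DW].
rewrite (metric_piD hE)//; [|exact: T (bracket_vf LC oO vN vZ) Op|exact: DW].
rewrite (eq_semisym LC oO U vB (vfD vP vN) vZ vZ)//;
  last by move=> q Oq; exact: piD_decomp.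
rewrite (metric_semisymDl LC oO vU)// -/N -addrA; congr (_ + _).
rewrite (metric_semisym LC oO vU)// NF// NF// mulr0 mul0r addr0 subr0.
rewrite -(torsion_free LC oO)// metricBl//; last 2 first.
- exact: T (nabla_vf vN vZ) Op.
- exact: T (nabla_vf vZ vN) Op.
rewrite (metric_nabla_orth vZ vN vW)// ?opprK => [|q Oq]; last exact: NF.
congr (_ + _); rewrite -(metric_piDperp hE Op tZW (oN p Op)).
rewrite metricC//; last exact: (piDperp_tangent hE Op tZW).
rewrite (metric_piDperp hE Op (T vB Op) (piDperp_orth hE Op tZW)).
by rewrite metricC//; [exact: (piDperp_tangent hE Op tZW)|exact: T vB Op].
Qed.

(** The connection terms are those of [gauss_semisymD2] for (X, Y) and for
    (Y, X); the bracket is split along D and its complement, and the two halves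
    are recombined by [gauss_bracket]. *)
Lemma gauss_equation X Y Z W p : VF X -> VF Y -> VF Z -> VF W ->
  (forall q, O q -> D q (Z q)) -> (forall q, O q -> D q (W q)) -> O p ->
  semisym_curvD4 g nabla D U X Y Z W p
  = <|semisym_curv g nabla U X Y Z, W|>_p
    + <|semisym_sff Y Z, semisym_sff X W|>_p
    - <|semisym_sff X Z, semisym_sff Y W|>_p
    - <|lie_bracket X Y, sff Z W|>_p.
Proof.
move=> vX vY vZ vW DZ DW Op; have tW := T vW Op.
have vB := bracket_vf LC oO vX vY.
have vP := vf_piD vB; have vN := vf_piDperp vB.
have vDD V V' : VF V -> VF V' -> VF (semisymD V V').
  by move=> vV vV'; exact/vf_piD/semisym_vf.
rewrite /semisym_curvD4.
have -> : semisym_curvD g nabla D U X Y Z p = semisymD X (semisymD Y Z) p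
  - semisymD Y (semisymD X Z) p - semisymD (piD (lie_bracket X Y)) Z p
  - piD (lie_bracket (piDperp (lie_bracket X Y)) Z) p by [].
have -> : semisym_curv g nabla U X Y Z p = semisym X (semisym Y Z) p
  - semisym Y (semisym X Z) p - semisym (lie_bracket X Y) Z p by [].
have t1 := T (vDD _ _ vX (vDD _ _ vY vZ)) Op.
have t2 := T (vDD _ _ vY (vDD _ _ vX vZ)) Op.
have t3 := T (vDD _ _ vP vZ) Op.
rewrite metricBl//; [|exact: (tangentB (tangentB t1 t2) t3)|].
  rewrite metricBBl// metricBBl//.
  2: by exact: T (semisym_vf vX (semisym_vf vY vZ)) Op.
  2: by exact: T (semisym_vf vY (semisym_vf vX vZ)) Op.
  2: by exact: T (semisym_vf vB vZ) Op.
  rewrite !gauss_semisymD2//; have := gauss_bracket vX vY vZ vW DZ DW Op.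
  by lra.
exact: T (vf_piD (bracket_vf LC oO vN vZ)) Op.
Qed.

End Gauss.

(** * The Chen-Ricci type inequality *)

Lemma sum_ord_first (V : nmodType) (n : nat) (f : 'I_n -> V) (i0 : 'I_n) :
  i0 = 0%N :> nat -> \sum_i f i = f i0 + \sum_(i < n | (0 < i)%N) f i.
Proof.
move=> i00; rewrite (bigD1 i0)//=; congr (_ + _); apply: eq_bigl => i.
by rewrite -val_eqE/= i00 lt0n.
Qed.

Section Invariance.
Context {R : realType} {m : nat} {M : smooth_manifold R m}.
Variables (g : riemannian_metric M).
Variables (nabla : tfield M R -> tfield M R -> tfield M R).
Hypothesis LC : levi_civita g nabla.
Variables (O : set M) (oO : open O) (U : tfield M R).
Implicit Types (X Y : tfield M R) (p : M).
Local Notation VF := (vector_field O).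

(** X and the first frame field are only assumed to agree on O, so exchanging
    them in B~ and in alpha relies on locality of the connection. *)
Lemma eq_semisym_sff D X Y p : VF X -> VF Y ->
  (forall q, O q -> X q = Y q) -> O p ->
  semisym_sff g nabla D U X X p = semisym_sff g nabla D U Y Y p.
Proof.
move=> vX vY XY Op; rewrite /semisym_sff /piDperp /orth_proj.
by rewrite (eq_semisym LC oO U vX vY vX vY).
Qed.

Lemma eq_alpha X Y p : VF X -> VF Y -> (forall q, O q -> X q = Y q) -> O p ->
  alpha g nabla U X X p = alpha g nabla U Y Y p.
Proof.
move=> vX vY XY Op; rewrite /alpha /omega.
rewrite (eq_nabla LC oO vX vY vX vY)// XY//.
by rewrite (tangent_eq_on oO Op (vf_tangent vY Op) (h := omega g U Y))// => q Oq;
  rewrite /omega XY.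
Qed.

(** For an orthonormal pair the denominator of the sectional curvature is 1. *)
Lemma curvature_orthonormal (c : R) X Y p :
  constant_sectional_curvature g nabla c -> VF X -> VF Y -> O p ->
  g p (X p) (X p) = 1 -> g p (Y p) (Y p) = 1 -> g p (X p) (Y p) = 0 ->
  g p (curvature nabla X Y Y p) (X p) = c.
Proof.
move=> hc vX vY Op XX YY XY.
have [tX tY] := (vf_tangent vX Op, vf_tangent vY Op).
rewrite -(hc O X Y p oO vX vY Op); last first.
  move=> a; rewrite big_ord_recl big_ord1 /= => a0 i.
  have tS : tangent p (a ord0 *: X p + a (lift ord0 ord0) *: Y p).
    by apply: tangentD; exact: tangentZ.
  have [b0 b1] : a ord0 = 0 /\ a (lift ord0 ord0) = 0.
    have := congr1 (fun v => g p v (X p)) a0.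
    have := congr1 (fun v => g p v (Y p)) a0.
    rewrite !metric0l// !metricDl ?metricZl ?(metricC g tY tX) ?XX ?YY ?XY//;
      try exact: tangentZ.
    by rewrite !mulr0 !mulr1 add0r addr0.
  case: i => -[|[|//]] i2; [rewrite -[RHS]b0|rewrite -[RHS]b1];
    by congr a; apply/val_inj.
by rewrite /sectional_curvature XX YY XY expr0n subr0 mulr1 divr1.
Qed.

End Invariance.

Theorem theorem2p13 (R : realType) (m n : nat) (M : smooth_manifold R m)
    (g : riemannian_metric M)
    (nabla : tfield M R -> tfield M R -> tfield M R)
    (hnabla : levi_civita g nabla)
    (D : M -> set (tvec M R)) (hn : (2 <= n)%N)
    (hD : smooth_distribution n D) (hDint : non_integrable D)
    (U : tfield M R) (hU : vector_field setT U)
    (c : R) (hc : constant_sectional_curvature g nabla c)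
    (X : tfield M R) (hX : section_of D X)
    (hX1 : forall p : M, g p (X p) (X p) = 1)
    (O : set M) (hO : open O) (E : 'I_n -> tfield M R)
    (hE : orthonormal_frame g D O E)
    (hE1 : forall i : 'I_n, i = 0%N :> nat ->
      forall p : M, O p -> E i p = X p)
    (p : M) (hp : O p) :
  semisym_ricD g nabla D U E X p
  <= (n%:R - 1) * c - lambda g nabla U E p
     + (2 - n%:R) * alpha g nabla U X X p
     + n%:R ^+ 2 / 4
       * g p (semisym_mean_curv g nabla D U E p)
             (semisym_mean_curv g nabla D U E p)
     + semisym_sff_norm2 g nabla D U E X p / 2
     + AD g nabla D E X p.
Proof.
have [[vE lE] oE] := hE; have LC := hnabla.
have vU : vector_field O U by exact: vf_subset hU.
have vX : vector_field O X by case: hX => vX _; exact: vf_subset vX.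
have DX q : O q -> D q (X q) by case: hX.
have DE i q : O q -> D q (E i q) by move=> Oq; exact: (frame_distribution hE).
pose i0 : 'I_n := Ordinal (ltnW hn); have i00 : i0 = 0%N :> nat by [].
have E0 q : O q -> E i0 q = X q by exact: hE1.
have T V : vector_field O V -> tangent p (V p).
  by move=> vV; exact: vf_tangent vV hp.
have tS V W : vector_field O V -> vector_field O W ->
    tangent p (semisym_sff g nabla D U V W p).
  move=> vV vW; apply: (piDperp_tangent hE hp).
  exact/T/(semisym_vf LC hO vU).
have tB V W : vector_field O V -> vector_field O W ->
    tangent p (sff g nabla D V W p).
  by move=> vV vW; apply: (piDperp_tangent hE hp); exact/T/(nabla_vf LC hO).
have XX : g p (X p) (X p) = 1 by [].
set a := alpha g nabla U X X p.
set b := semisym_sff g nabla D U X X p.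
(* The summands of Ric~D(X): Gauss equation, then Yano's formula with c for the
   Riemannian curvature, then - <u, v> <= (|u|^2 + |v|^2) / 2 for the mixed
   term.  The bracket term changes sign by antisymmetry of the bracket. *)
have term (j : 'I_n) : (0 < j)%N ->
    semisym_curvD4 g nabla D U X (E j) (E j) X p
    <= c - alpha g nabla U (E j) (E j) p - a
       + g p (semisym_sff g nabla D U (E j) (E j) p) b
       + (g p (semisym_sff g nabla D U X (E j) p)
              (semisym_sff g nabla D U X (E j) p)
          + g p (semisym_sff g nabla D U (E j) X p)
                (semisym_sff g nabla D U (E j) X p)) / 2
       + g p (sff g nabla D (E j) X p) (lie_bracket (E j) X p).
  move=> j0; have XF : g p (X p) (E j p) = 0.
    by rewrite -E0// oE// -val_eqE/= eq_sym gtn_eqF.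
  have FF : g p (E j p) (E j p) = 1 by rewrite oE// eqxx.
  have FX : g p (E j p) (X p) = 0 by rewrite metricC//; exact: T.
  rewrite (gauss_equation LC hO hE vU)//; last by move=> q; exact: DE.
  rewrite (metric_semisym_curv LC hO vU)// XX FF XF FX.
  rewrite (curvature_orthonormal hO hc)//.
  have := metric_le_halves g (tS _ _ vX (vE j)) (tS _ _ (vE j) vX).
  have -> : g p (lie_bracket X (E j) p) (sff g nabla D (E j) X p)
      = - g p (sff g nabla D (E j) X p) (lie_bracket (E j) X p).
    have tXE := T _ (nabla_vf LC hO vX (vE j)).
    have tEX := T _ (nabla_vf LC hO (vE j) vX).
    have tBj := tB _ _ (vE j) vX.
    rewrite -!(torsion_free LC hO)// (metricC g (tangentB tXE tEX) tBj).
    by rewrite -(metricNr g tBj (tangentB tEX tXE)) opprB.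
  by rewrite -/a -/b; lra.
have lambdaE : lambda g nabla U E p
    = a + \sum_(j < n | (0 < j)%N) alpha g nabla U (E j) (E j) p.
  by rewrite /lambda (sum_ord_first _ i00) (eq_alpha LC hO U (vE i0) vX).
set s := \sum_(j < n | (0 < j)%N) semisym_sff g nabla D U (E j) (E j) p.
have ts : tangent p s by apply: tangent_sum => j _; exact: tS.
have tb : tangent p b by exact: tS.
(* The square of n cancels the normalisation of the mean curvature. *)
have HE : n%:R ^+ 2 / 4 * g p (semisym_mean_curv g nabla D U E p)
    (semisym_mean_curv g nabla D U E p) = g p (s + b) (s + b) / 4.
  have -> : semisym_mean_curv g nabla D U E p = n%:R^-1 *: (s + b).
    rewrite /semisym_mean_curv (sum_ord_first _ i00).
    by rewrite (eq_semisym_sff LC hO U D (vE i0) vX)// addrC.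
  rewrite metricZl ?metricZr//; try by do ?[exact: tangentD|apply: tangentZ].
  have : n%:R != 0 :> R by rewrite pnatr_eq0 -lt0n ltnW.
  by move=> n0; field.
have := metric_le_quarter g ts tb.
have -> : g p s b = \sum_(j < n | (0 < j)%N)
    g p (semisym_sff g nabla D U (E j) (E j) p) b.
  by rewrite metric_suml// => j; exact: tS.
rewrite HE lambdaE /semisym_ricD /AD /semisym_sff_norm2.
have sum_const (x : R) : \sum_(j < n | (0 < j)%N) x = (n%:R - 1) * x.
  have := sum_ord_first (fun=> x) i00; rewrite sumr_const card_ord -mulr_natl.
  by lra.
have split4 (f1 f2 f3 f4 : 'I_n -> R) :
    \sum_(j < n | (0 < j)%N) (c - f1 j - a + f2 j + f3 j / 2 + f4 j)
    = (n%:R - 1) * c - \sum_(j < n | (0 < j)%N) f1 j - (n%:R - 1) * a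
      + \sum_(j < n | (0 < j)%N) f2 j + (\sum_(j < n | (0 < j)%N) f3 j) / 2
      + \sum_(j < n | (0 < j)%N) f4 j.
  by rewrite !big_split/= -!mulr_suml !sumrN !sum_const.
have := ler_sum (index_enum _) term; rewrite split4.
by lra.
Qed.
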